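(* For every dimension $d \geq 1$ there exists a constant $C$ (a positive integer depending only on $d$) such that for every integer $k \geq 1$ the number of chambers of the $k$-th Brillouin zone of $0 \in \mathbb{Z}^d$ is at most $f_{k-1}^{(d)}(Ck)$.
   Context: For $a \in \mathbb{Z}^d \setminus \{0\}$, the bisector of $0$ and $a$ is the hyperplane $\{x \in \mathbb{R}^d : \|x\| = \|x-a\|\}$. The chambers of the arrangement of these bisectors are the closures of the connected components of the complement in $\mathbb{R}^d$ of the union of all bisectors. The $k$-th Brillouin zone of $0$ in $\mathbb{Z}^d$ is the set of $x \in \mathbb{R}^d$ such that $\|x-a\| < \|x\|$ for at most $k-1$ points $a \in \mathbb{Z}^d\setminus\{0\}$ and $\|x-b\| \leq \|x\|$ for at least $k-1$ points $b \in \mathbb{Z}^d \setminus\{0\}$; it is the union of those chambers whose interior points are separated from $0$ by exactly $k-1$ bisectors, and these are its chambers. For a finite set $S \subseteq \mathbb{R}^d$ and an integer $j \geq 0$, a $j$-set of $S$ is a subset of $S$ of size $j$ that is the set of points of $S$ contained in the interior of some closed half-space. $f_j^{(d)}(n)$ denotes the maximum number of $j$-sets that any set of $n$ points in $\mathbb{R}^d$ can have. *)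

(* Defs.v *)
From HB Require Import structures.
From mathcomp Require Import all_boot all_order all_algebra.
From mathcomp Require Import finmap all_classical all_reals all_analysis.
From mathcomp Require Import ring lra zify.
Set Implicit Arguments.
Unset Strict Implicit.
Unset Printing Implicit Defensive.
Import Order.TTheory GRing.Theory Num.Theory.
Import numFieldNormedType.Exports.
Local Open Scope classical_set_scope.
Local Open Scope card_scope.
Local Open Scope ring_scope.

Definition dotp (R : realType) (d : nat) (x y : 'rV[R]_d) : R :=
  \sum_(i < d) x 0 i * y 0 i.

(* The library norm `|x| on 'rV[R]_d is the sup norm: it induces the usual
   topology, but distances must be measured with enorm. *)
Definition enorm (R : realType) (d : nat) (x : 'rV[R]_d) : R :=
  Num.sqrt (dotp x x).

Definition latpt (R : realType) (d : nat) (a : 'rV[int]_d) : 'rV[R]_d :=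
  map_mx intr a.
Arguments latpt R {d} a.

Definition bisector (R : realType) (d : nat) (a : 'rV[int]_d) :
    set 'rV[R]_d :=
  [set x | enorm x = enorm (x - latpt R a)].
Arguments bisector R {d} a.

Definition bisectors_union (R : realType) (d : nat) : set 'rV[R]_d :=
  \bigcup_(a in [set a : 'rV[int]_d | a != 0]) bisector R a.
Arguments bisectors_union : clear implicits.

Definition chambers (R : realType) (d : nat) : set (set 'rV[R]_d) :=
  [set closure (connected_component (~` bisectors_union R d) x)
     | x in ~` bisectors_union R d].
Arguments chambers : clear implicits.

(* As a != 0, the point 0 satisfies enorm 0 < enorm (0 - a); hence the bisector
   of 0 and a separates x from 0 exactly when x is nearer to a than to 0. *)
Definition closer (R : realType) (d : nat) (x : 'rV[R]_d) :
    set 'rV[int]_d :=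
  [set a | a != 0 /\ enorm (x - latpt R a) < enorm x].

Definition weakly_closer (R : realType) (d : nat) (x : 'rV[R]_d) :
    set 'rV[int]_d :=
  [set b | b != 0 /\ enorm (x - latpt R b) <= enorm x].

Definition brillouin_zone (R : realType) (d k : nat) : set 'rV[R]_d :=
  [set x | closer x #<= `I_k.-1 /\ `I_k.-1 #<= weakly_closer x].
Arguments brillouin_zone : clear implicits.

(* Distinct a have distinct bisectors, so counting lattice points a counts
   separating bisectors. *)
Definition brillouin_chambers (R : realType) (d k : nat) :
    set (set 'rV[R]_d) :=
  [set C | chambers R d C /\ forall x, C° x -> closer x #= `I_k.-1].
Arguments brillouin_chambers : clear implicits.

Definition closed_half_space (R : realType) (d : nat) (H : set 'rV[R]_d) :
    Prop :=
  exists2 u : 'rV[R]_d, u != 0 & exists c : R, H = [set x | c <= dotp u x].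

Definition is_jset (R : realType) (d j : nat) (S T : {fset 'rV[R]_d}) : Prop :=
  #|` T| = j /\
  exists2 H, closed_half_space H & [set` T] = [set` S] `&` H°.

Definition jsets (R : realType) (d j : nat) (S : {fset 'rV[R]_d}) :
    {fset {fset 'rV[R]_d}} :=
  [fset T in fpowerset S | `[< is_jset j S T >]]%fset.

(* The maximum of #|` jsets j S| over the n-point sets S. The range 2 ^ n of
   the big operator loses nothing, see card_jsets_le_max. *)
Definition max_jsets (R : realType) (d j n : nat) : nat :=
  \max_(m < (2 ^ n).+1 |
      `[< exists2 S : {fset 'rV[R]_d}, #|` S| = n & #|` jsets j S| = m >]) m.

Lemma in_jsets (R : realType) (d j : nat) (S T : {fset 'rV[R]_d}) :
  T \in jsets j S <-> is_jset j S T.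
Proof.
rewrite !inE; split => [/andP[_ /asboolP//]|jT]; apply/andP; split.
  rewrite fpowersetE; apply/fsubsetP => x xT.
  have [_ [H _ TS]] := jT; have : [set` T] x by [].
  by rewrite TS => -[].
exact/asboolP.
Qed.

Lemma card_jsets_le_max (R : realType) (d j : nat) (S : {fset 'rV[R]_d}) :
  (#|` jsets j S| <= max_jsets R d j #|` S|)%N.
Proof.
have le2 : (#|` jsets j S| < (2 ^ #|` S|).+1)%N.
  rewrite ltnS -card_fpowerset; apply: fsubset_leq_card.
  by apply/fsubsetP => T; rewrite !inE => /andP[].
apply: (@leq_bigmax_cond _ _ (fun m : 'I_(2 ^ #|` S|).+1 => m : nat)
          (Ordinal le2)).
by apply/asboolP; exists S.
Qed.

Lemma max_jsets_attained (R : realType) (d j n : nat) : (0 < d)%N ->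
  exists2 S : {fset 'rV[R]_d}, #|` S| = n & #|` jsets j S| = max_jsets R d j n.
Proof.
move=> d0.
have [S Sn] : exists S : {fset 'rV[R]_d}, #|` S| = n.
  exists [fset (const_mx (i : 'I_n)%:R : 'rV[R]_d) | i : 'I_n]%fset.
  rewrite card_imfset /= ?size_enum_ord // => a b.
  move=> /matrixP/(_ 0 (Ordinal d0)); rewrite !mxE => /eqP.
  by rewrite eqr_nat => /eqP/val_inj.
have le2 : (#|` jsets j S| < (2 ^ n).+1)%N.
  rewrite ltnS -Sn -card_fpowerset; apply: fsubset_leq_card.
  by apply/fsubsetP => T; rewrite !inE => /andP[].
have [m mP Em] : {m : 'I_(2 ^ n).+1 | `[< exists2 S : {fset 'rV[R]_d},
    #|` S| = n & #|` jsets j S| = m >] & max_jsets R d j n = m}.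
  apply: eq_bigmax_cond; apply/card_gt0P; exists (Ordinal le2).
  by apply/asboolP; exists S.
by have /asboolP[S' S'n S'm] := mP; exists S' => //; rewrite Em.
Qed.

Section zone.
Variables (R : realType) (d : nat).
Implicit Types (x y z : 'rV[R]_d) (a : 'rV[int]_d).

Let side a x : R := \sum_(i < d) (x 0 i ^+ 2 - (x 0 i - (a 0 i)%:~R) ^+ 2).

Let sideE a x : side a x =
  dotp x x - dotp (x - latpt R a) (x - latpt R a).
Proof.
by rewrite /side sumrB; congr (_ - _); apply: eq_bigr => i _; rewrite !mxE.
Qed.

Let dotp_ge0 x : 0 <= dotp x x.
Proof. by apply: sumr_ge0 => i _; rewrite -expr2 sqr_ge0. Qed.

Let closerE a x : closer x a <-> a != 0 /\ 0 < side a x.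
Proof.
rewrite /closer /= sideE subr_gt0 /enorm; split=> -[a0 h]; split => //.
  by move: h; rewrite ltNge ler_sqrt // -ltNge.
by rewrite ltNge ler_sqrt // -ltNge.
Qed.

Let weakly_closerE a x : weakly_closer x a <-> a != 0 /\ 0 <= side a x.
Proof. by rewrite /weakly_closer /= sideE subr_ge0 /enorm ler_sqrt. Qed.

Let bisectorE a x : bisector R a x <-> side a x = 0.
Proof.
rewrite /bisector /= sideE /enorm; split => [/eqP|/eqP].
  by rewrite eqr_sqrt // => /eqP ->; rewrite subrr.
by rewrite subr_eq0 => /eqP ->.
Qed.

Let side_cont a : continuous (side a).
Proof.
apply: continuous_big => [|i _ x]; first exact: add_continuous.
have h : x 0 i @[x --> x] --> x 0 i by exact: coord_continuous.
have h' : x 0 i - (a 0 i)%:~R @[x --> x] --> x 0 i - (a 0 i)%:~R.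
  by apply: cvgB => //; apply: cvg_cst.
exact: (cvgB (cvgM h h) (cvgM h' h')).
Qed.

Let sides_near x : \forall y \near x, forall a, a != 0 ->
  (0 < side a x -> 0 < side a y) /\ (side a x < 0 -> side a y < 0).
Proof.
have [M Mx] : exists M : nat, forall i, `|x 0 i| + 1 <= M%:R.
  exists (\max_(i < d) (Num.trunc (`|x 0 i| + 1)%R).+1)%N => i.
  apply: le_trans (ltW (truncnS_gt _)) _; rewrite ler_nat.
  exact: (@leq_bigmax _ (fun i => (Num.trunc (`|x 0 i| + 1)).+1)).
pose N := (M + d * M + 1)%N.
have far a y i : ball x 1 y -> (N%:R <= `|(a 0 i)%:~R : R|) -> side a y < 0.
  move=> [_ xy] Ni.
  have yMn j : `|y 0 j| <= M%:R.
    have := xy 0 j; have := Mx j; rewrite /ball /= => h1 h2.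
    apply: (le_trans _ h1); rewrite -lerBlDl (le_trans (lerB_dist _ _)) //.
    by rewrite distrC ltW.
  have yM j : y 0 j ^+ 2 <= M%:R ^+ 2.
    by rewrite -real_normK ?num_real // lerXn2r ?nnegrE.
  have kN : 0 <= (`|(a 0 i)%:~R : R| - N%:R) by rewrite subr_ge0.
  have ai : (d%:R * M%:R + 1) ^+ 2 <= (y 0 i - (a 0 i)%:~R) ^+ 2.
    rewrite -[leRHS]real_normK ?num_real // lerXn2r ?nnegrE ?addr_ge0 ?mulr_ge0 //.
    have h := lerB_dist (a 0 i)%:~R (y 0 i); rewrite distrC in h.
    apply: (le_trans _ h); rewrite lerBrDr; apply: (le_trans _ Ni).
    rewrite /N !natrD natrM; have := yMn i; lra.
  rewrite /side (bigD1 i) //= -subr_gt0 sub0r opprD.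
  have hs : \sum_(j < d | j != i) (y 0 j ^+ 2 - (y 0 j - (a 0 j)%:~R) ^+ 2)
      <= d.-1%:R * M%:R ^+ 2.
    apply: (@le_trans _ _ (\sum_(j < d | j != i) M%:R ^+ 2)).
      by apply: ler_sum => j _; rewrite lerBlDr (le_trans (yM j)) // lerDl sqr_ge0.
    by rewrite sumr_const cardC1 card_ord mulr_natl.
  have dM : 0 <= d%:R * M%:R :> R by rewrite mulr_ge0.
  have dM2 : d%:R * M%:R ^+ 2 <= (d%:R * M%:R + 1) ^+ 2 - 1 :> R.
    have d1 : 0 <= d%:R - 1 :> R.
      by rewrite subr_ge0 ler1n (leq_trans _ (ltn_ord i)).
    have dM3 : 0 <= (d%:R - 1) * (d%:R * M%:R ^+ 2) :> R.
      by rewrite !mulr_ge0 // exprn_ge0.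
    nra.
  have dd : d%:R = d.-1%:R + 1 :> R by rewrite natr1 prednK // (leq_trans _ (ltn_ord i)).
  have dM4 : d%:R * M%:R ^+ 2 = d.-1%:R * M%:R ^+ 2 + M%:R ^+ 2 :> R.
    by rewrite dd mulrDl mul1r.
  have := yM i; lra.
have near1 : \forall y \near x, ball x 1 y by apply: nbhsx_ballx.
pose av (f : {ffun 'I_d -> 'I_(N + N).+1}) : 'rV[int]_d :=
  \row_i ((f i : nat)%:Z - N%:Z).
pose good a y := (0 < side a x -> 0 < side a y) /\ (side a x < 0 -> side a y < 0).
have nearF : \forall y \near x,
    forall f : {ffun 'I_d -> 'I_(N + N).+1}, good (av f) y.
  apply: (@filter_forall _ _ (fun f => good (av f)) (nbhs x)) => f.
  move: (av f) => a.
  have pos : \forall y \near x, 0 < side a x -> 0 < side a y.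
    have [x0|_] := boolP (0 < side a x); last by apply: filterE.
    have : \forall y \near x, 0 < side a y by exact: (side_cont (lt_nbhsr x0)).
    by apply: filterS.
  have neg : \forall y \near x, side a x < 0 -> side a y < 0.
    have [x0|_] := boolP (side a x < 0); last by apply: filterE.
    have : \forall y \near x, side a y < 0 by exact: (side_cont (lt_nbhsl x0)).
    by apply: filterS.
  by apply: filterS2 pos neg => y A B; split.
near=> y => a a0.
have [/existsP[i Ni]|/existsPn aN] :=
    boolP [exists i, N%:R <= `|(a 0 i)%:~R : R|].
  have sx : side a x < 0 by apply: (far a x i _ Ni); exact: ballxx.
  have sy : side a y < 0 by apply: (far a y i _ Ni); near: y.
  by split => //; rewrite ltNge ltW.
have : forall f : {ffun 'I_d -> 'I_(N + N).+1},
    good (av f) y by near: y.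
move=> /(_ [ffun i => inord `|(a 0 i + N%:Z)%R|%N]) /=.
suff <- : a = av [ffun i => inord `|(a 0 i + N%:Z)%R|%N] by [].
apply/rowP => i; rewrite !mxE ffunE.
have : (`|a 0 i| < N%:Z)%R.
  by have := aN i; rewrite -ltNge -intr_norm -[N%:R]/(N%:Z%:~R) ltr_int.
rewrite ltr_norml => /andP[h1 h2].
have h3 : 0 <= a 0 i + N%:Z by lia.
rewrite inordK; last by lia.
lia.
Unshelve. all: by end_near.
Qed.

Let U := bisectors_union R d.

Let outU x : (~` U) x <-> forall a, a != 0 -> side a x != 0.
Proof.
split=> [xU a a0|h [a /= a0 /bisectorE/eqP]]; last by apply/negP/h.
by apply/eqP => /bisectorE xa; apply: xU; exists a.
Qed.

Let open_outU : open (~` U).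
Proof.
rewrite openE => x /outU xU; rewrite /interior.
have := sides_near x; apply: filterS => y hy; apply/outU => a a0.
have [h1 h2] := hy a a0.
by have := xU a a0; rewrite !neq_lt => /orP[/h2 ->|/h1 ->]; rewrite ?orbT.
Qed.

Let K z := connected_component (~` U) z.

Let line y z (t : R) : 'rV[R]_d := y + t *: (z - y).

Let line_cont y z : continuous (line y z).
Proof.
move=> t; apply: cvgD; first exact: cvg_cst.
by apply: cvgZr_tmp; exact: cvg_id.
Qed.

Let open_K z : open (K z).
Proof.
rewrite openE => y Ky; rewrite /interior.
have yU := connected_component_sub Ky.
have /nbhs_ballP[e /= e0 eU] : nbhs y (~` U) by apply: open_nbhs_nbhs.
apply/nbhs_ballP; exists e => //= w yw.
apply: connected_component_trans Ky _.
pose L := line y w @` `[0, 1].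
have cL : connected L.
  apply: connected_continuous_connected; first exact: segment_connected.
  exact: continuous_subspaceT (@line_cont y w).
have LU : L `<=` ~` U.
  move=> _ [t tI <-]; apply: eU.
  move: tI; rewrite /= in_itv /= => /andP[t0 t1].
  move: yw; rewrite -ball_normE /= => yw.
  rewrite /line opprD addrA subrr add0r normrN normrZ ger0_norm // (distrC w).
  apply: le_lt_trans yw.
  by rewrite ler_piMl.
have Ly : L y by exists 0; rewrite /= ?in_itv /= ?lexx ?ler01 // /line scale0r addr0.
apply: (connected_component_max Ly LU cL).
by exists 1; rewrite /= ?in_itv /= ?lexx ?ler01 // /line scale1r addrC subrK.
Qed.

Let side_K z x y a : a != 0 -> K z x -> K z y -> 0 < side a x -> 0 < side a y.
Proof.
move=> a0 Kx Ky sx; rewrite ltNge; apply/negP => sy.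
have : connected (side a @` K z).
  apply: connected_continuous_connected; first exact: component_connected.
  exact: continuous_subspaceT (@side_cont a).
move=> /connected_intervalP I0.
have sy0 : side a y <= 0 <= side a x by rewrite sy ltW.
have [||w Kw /eqP] := I0 (side a y) (side a x) _ _ 0 sy0; [by exists y|by exists x|].
by have /outU/(_ a a0)/negP := connected_component_sub Kw.
Qed.

Let side_clK z x y a : a != 0 -> closure (K z) x -> K z y ->
  (0 < side a x -> 0 < side a y) /\ (side a x < 0 -> side a y < 0).
Proof.
move=> a0 Kx Ky.
have [w [Kw hw]] := Kx _ (sides_near x).
have [h1 h2] := hw a a0; split => [/h1|/h2 sw]; first by apply: (side_K a0 Kw Ky).
have /outU/(_ a a0) := connected_component_sub Ky.
rewrite neq_lt => /orP[//|sy].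
by have := side_K a0 Ky Kw sy; rewrite ltNge ltW.
Qed.

Let closer_int z x : K z z -> (closure (K z))° x -> closer x = closer z.
Proof.
move=> Kz Cx; apply/seteqP; split=> a /closerE[a0 sa]; apply/closerE; split=> //.
  by have [+ _] := side_clK a0 (interior_subset Cx) Kz; exact.
have [_ h] := side_clK a0 (interior_subset Cx) Kz.
rewrite lt_neqAle leNgt; apply/andP; split; last first.
  by apply/negP => /h; rewrite ltNge ltW.
rewrite eq_sym; apply/eqP => sx.
pose l t := line x (x - latpt R a) t.
have : \forall t \near (0 : R), closure (K z) (l t).
  have l0 : l 0 = x by rewrite /l /line scale0r addr0.
  by apply: (@line_cont x (x - latpt R a) 0); rewrite -/(l 0) l0.
move=> /nbhs_ballP[e /= e0 el].
have t0 : 0 < e / 2 by rewrite divr_gt0.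
have /el Kt : ball 0 e (e / 2).
  by rewrite /ball /= sub0r normrN gtr0_norm // ltr_pdivrMr // ltr_pMr // ltr1n.
have [_ h'] := side_clK a0 Kt Kz.
suff : side a (l (e / 2)) < 0 by move=> /h'; rewrite ltNge ltW.
have -> : side a (l (e / 2)) = side a x - e * dotp (latpt R a) (latpt R a).
  rewrite /side /dotp mulr_sumr -sumrB; apply: eq_bigr => i _.
  by rewrite /l /line !mxE; field.
rewrite sx sub0r oppr_lt0 mulr_gt0 // lt_neqAle dotp_ge0 andbT eq_sym.
apply: contra a0; rewrite psumr_eq0 => [|i _]; last by rewrite -expr2 sqr_ge0.
move=> /allP a0; apply/eqP/rowP => i; have := a0 i (mem_index_enum i).
by rewrite !mxE mulf_eq0 orbb intr_eq0 => /eqP.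
Qed.

Lemma brillouin_chambersE (k : nat) (C : set 'rV[R]_d) :
  brillouin_chambers R d k C <->
  chambers R d C /\ C `<=` brillouin_zone R d k.
Proof.
split=> -[[z zU zC] H]; (split; first by exists z); rewrite -/(K z) in zC.
  have Kz : K z z by exact: connected_component_refl.
  have zk : closer z #= `I_k.-1.
    apply: H; rewrite -zC; apply: (interiorS (@subset_closure _ (K z))).
    by apply: open_nbhs_nbhs; split => //; exact: open_K.
  move=> x; rewrite -zC => Cx; split.
    rewrite -(card_le_eqr zk); apply: subset_card_le => a /closerE[a0 sx].
    by apply/closerE; split => //; apply: (side_clK a0 Cx Kz).1.
  rewrite -(card_le_eql zk); apply: subset_card_le => a /closerE[a0 sz].
  apply/weakly_closerE; split => //; rewrite leNgt; apply/negP => sx.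
  by have := (side_clK a0 Cx Kz).2 sx; rewrite ltNge ltW.
have Kz : K z z by exact: connected_component_refl.
move=> x; rewrite -zC => /(closer_int Kz) ->.
have [h1 h2] : brillouin_zone R d k z.
  by apply: H; rewrite -zC; exact: subset_closure.
rewrite card_eq_le h1 /=; apply: card_le_trans h2 _; apply: subset_card_le.
move=> a /weakly_closerE[a0 sz]; apply/closerE; split => //.
by rewrite lt_neqAle sz andbT eq_sym; move/outU : zU; exact.
Qed.

End zone.

(* Main.v *)
Require Import Defs.
From HB Require Import structures.
From mathcomp Require Import all_boot all_order all_algebra.
From mathcomp Require Import finmap all_classical all_reals all_analysis.
From mathcomp Require Import ring lra zify.
Import Order.TTheory GRing.Theory Num.Theory.
Import numFieldNormedType.Exports.
Local Open Scope classical_set_scope.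
Local Open Scope card_scope.
Local Open Scope ring_scope.

(** Expanding |x - a|^2 shows that a is nearer to x than 0 is iff
    |a|^2 < 2 <x, a>.  Dividing by |a|^2, this says that the inverted point
    a / |a|^2 lies in the open half-space {p | 1/2 < <x, p>}.  So if B is a
    finite set of nonzero lattice points that contains every lattice point
    nearer than 0 to a point x off the bisectors, and j is the number of those
    points, then their inversions form a j-set of the inversion of B
    ([closer_jset]).

    A chamber is determined by the set of lattice points that are nearer than
    0 to one of its interior points: when two points off the bisectors have
    the same such set, each bisector leaves both on the same strict side, so the
    segment joining them avoids the bisectors ([same_component]).  Inversion is
    injective, so distinct chambers of the k-th zone give distinct
    (k-1)-sets, and it remains to find one B of size C k that serves all of
    them.

    This is a volume estimate.  Take m with k <= m^d <= 2^d k.  If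
    d m^2 < |x|^2, the open ball around x through 0 contains a cube of m^d
    lattice points ([card_cube_closer]), more than the k - 1 that a point x of
    the k-th zone allows.  Hence |x| is at most d m, and the points nearer to
    x than 0 have coordinates at most 2 d m in absolute value
    ([closer_coord_le]).  The lattice points of this box number at most
    (4 d m + 1)^d <= (5 d m)^d <= (10 d)^d k, which gives C = (10 d)^d.  Points
    added to B to reach the size C k exactly do no harm: they are not nearer
    than 0 to any of the x considered, so their inversions stay out of the
    half-spaces. *)

(** * The Euclidean inner product *)

Lemma dotpBB {R : realType} {d : nat} (x y : 'rV[R]_d) :
  dotp (x - y) (x - y) = dotp x x - 2 * dotp x y + dotp y y.
Proof.
rewrite /dotp mulr_sumr -sumrB -big_split /=; apply: eq_bigr => i _.
by rewrite !mxE; ring.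
Qed.

Lemma dotpZr {R : realType} {d : nat} (c : R) (x y : 'rV[R]_d) :
  dotp x (c *: y) = c * dotp x y.
Proof. by rewrite /dotp mulr_sumr; apply: eq_bigr => i _; rewrite mxE; ring. Qed.

Lemma dotpC {R : realType} {d : nat} (x y : 'rV[R]_d) : dotp x y = dotp y x.
Proof. by apply: eq_bigr => i _; rewrite mulrC. Qed.

Lemma dotp_seg {R : realType} {d : nat} (x y z : 'rV[R]_d) (t : R) :
  dotp (x + t *: (y - x)) z = (1 - t) * dotp x z + t * dotp y z.
Proof.
rewrite /dotp !mulr_sumr -big_split /=; apply: eq_bigr => i _.
by rewrite !mxE; ring.
Qed.

Lemma sqr_coord_le_dotp {R : realType} {d : nat} (x : 'rV[R]_d) i :
  x 0 i ^+ 2 <= dotp x x.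
Proof.
rewrite /dotp (bigD1 i) //= -expr2 lerDl.
by apply: sumr_ge0 => j _; rewrite -expr2 sqr_ge0.
Qed.

Lemma dotp_ge0 {R : realType} {d : nat} (x : 'rV[R]_d) : 0 <= dotp x x.
Proof. by apply: sumr_ge0 => i _; rewrite -expr2 sqr_ge0. Qed.

Lemma dotp_gt0 {R : realType} {d : nat} (x : 'rV[R]_d) : x != 0 -> 0 < dotp x x.
Proof.
move=> /rV0Pn[i xi]; apply: lt_le_trans (sqr_coord_le_dotp x i).
by rewrite lt_neqAle sqr_ge0 andbT eq_sym sqrf_eq0.
Qed.

(** Comparison with the sup norm: a cube of half-side c lies in the ball of
    radius sqrt d * c. *)
Lemma dotp_le_sup {R : realType} {d : nat} (x : 'rV[R]_d) (c : R) :
  (forall i, `|x 0 i| <= c) -> dotp x x <= d%:R * c ^+ 2.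
Proof.
move=> xc; rewrite mulr_natl -[d in leRHS]card_ord -sumr_const.
apply: ler_sum => i _; rewrite -expr2 -real_normK ?num_real //.
by rewrite lerXn2r ?nnegrE // (le_trans _ (xc i)).
Qed.

Lemma continuous_dotp {R : realType} {d : nat} (u : 'rV[R]_d) :
  continuous (dotp u).
Proof.
apply: continuous_big => [|i _ x]; first exact: add_continuous.
have xi : y 0 i @[y --> x] --> x 0 i by exact: coord_continuous.
exact: (cvgM (cvg_cst (u 0 i)) xi).
Qed.

(** * Nearness as a linear inequality *)

Lemma latpt_inj {R : realType} {d : nat} : injective (@latpt R d).
Proof.
move=> a b /rowP ab; apply/rowP => i; apply: (@intr_inj R).
by have := ab i; rewrite !mxE.
Qed.

Lemma latpt_neq0 {R : realType} {d : nat} (a : 'rV[int]_d) :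
  a != 0 -> latpt R a != 0.
Proof.
apply: contra => /eqP a0; apply/eqP/(@latpt_inj R); rewrite a0.
by apply/rowP => i; rewrite !mxE.
Qed.

Lemma closerP {R : realType} {d : nat} (x : 'rV[R]_d) (a : 'rV[int]_d) :
  closer x a <-> a != 0 /\ dotp (latpt R a) (latpt R a) < 2 * dotp x (latpt R a).
Proof.
suff -> : (dotp (latpt R a) (latpt R a) < 2 * dotp x (latpt R a)) =
  (enorm (x - latpt R a) < enorm x) by [].
rewrite /enorm [RHS]ltNge ler_sqrt ?dotp_ge0 // -ltNge dotpBB.
by apply/idP/idP; lra.
Qed.

Lemma bisectorP {R : realType} {d : nat} (x : 'rV[R]_d) (a : 'rV[int]_d) :
  bisector R a x <-> 2 * dotp x (latpt R a) = dotp (latpt R a) (latpt R a).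
Proof.
rewrite /bisector /= /enorm; split => [/eqP|h].
  by rewrite eqr_sqrt ?dotp_ge0 // dotpBB => /eqP; lra.
by congr Num.sqrt; rewrite dotpBB h; ring.
Qed.

Lemma out_bisectorsP {R : realType} {d : nat} (x : 'rV[R]_d) :
  (~` bisectors_union R d) x <->
  forall a : 'rV[int]_d, a != 0 ->
    2 * dotp x (latpt R a) != dotp (latpt R a) (latpt R a).
Proof.
split=> [xU a a0|h [a /= a0 /bisectorP/eqP]]; last by apply/negP/h.
by apply/eqP => /bisectorP xa; apply: xU; exists a.
Qed.

(** * Chambers and their sets of nearer points *)

Lemma seg_lt {R : realType} (t p q r : R) : 0 <= t -> t <= 1 ->
  p < r -> q < r -> (1 - t) * p + t * q < r.
Proof.
move=> t0 t1 pr qr; have [->|tn0] := eqVneq t 0; first by lra.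
have : 0 < t * (r - q) by rewrite mulr_gt0 ?subr_gt0 // lt_neqAle eq_sym tn0.
have : 0 <= (1 - t) * (r - p) by rewrite mulr_ge0 ?subr_ge0 // ltW.
by lra.
Qed.

(** Equal sets of nearer points, together with the absence of equality in any
    bisector equation, put x and y on the same strict side of each bisector;
    half-spaces are convex, so the segment from x to y meets no bisector. *)
Lemma same_component {R : realType} {d : nat} (x y : 'rV[R]_d) :
  (~` bisectors_union R d) x -> (~` bisectors_union R d) y ->
  closer x = closer y ->
  connected_component (~` bisectors_union R d) x =
  connected_component (~` bisectors_union R d) y.
Proof.
move=> xU yU xy; apply: same_connected_component.
pose l (t : R) := x + t *: (y - x).
have cl : continuous l.
  move=> t; apply: cvgD; first exact: cvg_cst.
  by apply: cvgZr_tmp; exact: cvg_id.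
apply: (@connected_component_max _ _ (l @` `[0, 1])).
- by exists 0; rewrite /= ?in_itv /= ?lexx ?ler01 // /l scale0r addr0.
- move=> _ [t /= + <-]; rewrite in_itv /= => /andP[t0 t1].
  apply/out_bisectorsP => a a0; rewrite /l dotp_seg.
  have /out_bisectorsP/(_ a a0) xa := xU.
  have /out_bisectorsP/(_ a a0) ya := yU.
  have : closer x a <-> closer y a by rewrite xy.
  rewrite !closerP => -[h1 h2].
  move: xa ya h1 h2; set p := dotp x _; set q := dotp y _; set r := dotp _ _.
  rewrite !neq_lt => /orP[p1|p1] /orP[q1|q1] h1 h2; apply/orP.
  + by left; have := seg_lt _ _ _ _ t0 t1 p1 q1; lra.
  + by have [] := h2 (conj a0 q1); lra.
  + by have [] := h1 (conj a0 p1); lra.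
  + right; have := seg_lt t (- (2 * p)) (- (2 * q)) (- r) t0 t1.
    by rewrite !ltrN2 => /(_ p1 q1); lra.
- apply: connected_continuous_connected; first exact: segment_connected.
  exact: continuous_subspaceT.
- by exists 1; rewrite /= ?in_itv /= ?lexx ?ler01 // /l scale1r addrC subrK.
Qed.

(** * Size of the sets of nearer points *)

(** The cube consists of the points floor(x) + f with 0 <= f_i < m, each of
    whose coordinates is within m of that of x.  It thus lies in the open ball
    around x of radius |x|, which also excludes the origin. *)
Lemma card_cube_closer {R : realType} {d : nat} (x : 'rV[R]_d) (m : nat) :
  (0 < m)%N -> d%:R * m%:R ^+ 2 < dotp x x -> `I_(m ^ d) #<= closer x.
Proof.
move=> m0 xm.
pose g (f : {ffun 'I_d -> 'I_m}) : 'rV[int]_d :=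
  \row_i (Num.floor (x 0 i) + (f i : nat)%:Z).
have g_inj : injective g.
  move=> f f' /rowP ff'; apply/ffunP => i; apply: val_inj.
  by have := ff' i; rewrite !mxE => /addrI[].
have gx f : closer x (g f).
  have gd : dotp (x - latpt R (g f)) (x - latpt R (g f)) < dotp x x.
    apply: le_lt_trans xm; apply: dotp_le_sup => i; rewrite !mxE intrD -pmulrn.
    have := floor_itv (x 0 i); rewrite intrD => /andP[h1 h2].
    have h3 : (f i)%:R + 1 <= m%:R :> R by rewrite natr1 ler_nat.
    have h4 : 0 <= (f i)%:R :> R by [].
    by rewrite ler_norml; apply/andP; split; lra.
  split; last by rewrite /enorm ltNge ler_sqrt ?dotp_ge0 // -ltNge.
  apply/eqP => g0; move: gd; rewrite g0.
  have -> : latpt R (0 : 'rV[int]_d) = 0 by apply/rowP => i; rewrite !mxE.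
  by rewrite subr0 ltxx.
pose h (k : 'I_#|{: {ffun 'I_d -> 'I_m}}|) := g (enum_val k).
have hx : range h `<=` closer x by move=> _ [k _ <-]; exact: gx.
apply: card_le_trans (subset_card_le hx).
have -> : (m ^ d = #|{: {ffun 'I_d -> 'I_m}}|)%N by rewrite card_ffun !card_ord.
rewrite (card_le_eql card_II) (card_le_eqr (inj_card_eq _)) //.
exact: in2W (inj_comp g_inj enum_val_inj).
Qed.

(** A nearer point a satisfies |a - x| < |x|, so both terms of
    a_i = (a_i - x_i) + x_i are at most |x|, and |x| <= sqrt d * m <= d m. *)
Lemma closer_coord_le {R : realType} {d : nat} (x : 'rV[R]_d) (m : nat)
    (a : 'rV[int]_d) i :
  dotp x x <= d%:R * m%:R ^+ 2 -> closer x a ->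
  `|a 0 i| <= (2 * d * m)%N%:Z.
Proof.
move=> xm [_]; rewrite /enorm ltNge ler_sqrt ?dotp_ge0 // -ltNge => ax.
have d1 : 1 <= d%:R :> R by rewrite ler1n (leq_trans _ (ltn_ord i)).
have coord (y : 'rV[R]_d) : dotp y y <= dotp x x -> `|y 0 i| <= d%:R * m%:R.
  move=> yx; rewrite -(@ler_pXn2r _ 2) ?nnegrE ?mulr_ge0 // real_normK ?num_real //.
  apply: le_trans (sqr_coord_le_dotp y i) _; apply: (le_trans yx).
  apply: (le_trans xm); rewrite exprMn ler_wpM2r ?sqr_ge0 // expr2.
  by rewrite ler_peMr.
rewrite -(ler_int R) intr_norm -pmulrn !natrM.
have := coord x (lexx _); have := coord _ (ltW ax); rewrite !mxE !ler_norml.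
by move=> /andP[h1 h2] /andP[h3 h4]; apply/andP; split; lra.
Qed.

Lemma box_fset {d : nat} (N : nat) :
  exists B : {fset 'rV[int]_d}, (#|` B| <= (2 * N).+1 ^ d)%N /\
    forall a, a \in B <-> a != 0 /\ forall i, `|a 0 i| <= N%:Z.
Proof.
pose g (f : {ffun 'I_d -> 'I_(2 * N).+1}) : 'rV[int]_d :=
  \row_i ((f i : nat)%:Z - N%:Z).
have gN f i : `|g f 0 i| <= N%:Z.
  rewrite mxE ler_norml; have := ltn_ord (f i).
  by move=> fi; apply/andP; split; lia.
have g_onto (a : 'rV[int]_d) :
    (forall i, `|a 0 i| <= N%:Z) -> exists f, a = g f.
  move=> aN; exists [ffun i => inord `|(a 0 i + N%:Z)%R|%N].
  apply/rowP => i; rewrite !mxE ffunE.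
  have := aN i; rewrite ler_norml => /andP[h1 h2].
  have h3 : 0 <= a 0 i + N%:Z by lia.
  by rewrite inordK; lia.
exists [fset a in [fset g f | f : {ffun 'I_d -> 'I_(2 * N).+1}] | a != 0]%fset.
split=> [|a].
  apply: leq_trans (fsubset_leq_card (fset_sub _ _)) _.
  apply: leq_trans (leq_imfset_card _ _ _) _.
  by rewrite /= -cardE card_ffun !card_ord.
rewrite !inE /=; split=> [/andP[/imfsetP[f _ ->] ->]|[a0 aN]].
  by split=> // i; exact: gN.
by rewrite a0 andbT; apply/imfsetP; have [f ->] := g_onto a aN; exists f.
Qed.

(** The maximum in the theorem is over sets with exactly C k points, while the
    box only provides at most that many. *)
Lemma fset_superset_card {T : choiceType} (A : set T) (B : {fset T}) (n : nat) :
  infinite_set A -> [set` B] `<=` A -> (#|` B| <= n)%N ->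
  exists B' : {fset T}, [/\ (B `<=` B')%fset, [set` B'] `<=` A & #|` B'| = n].
Proof.
move=> Ainf BA /subnK <-; elim: (n - _)%N => [|j [B' [BB' B'A B'n]]].
  by exists B.
have [a [Aa aB']] : A `\` [set` B'] !=set0.
  by apply: infinite_setN0; apply: infinite_setD.
exists (a |` B')%fset; split.
- exact: fsubset_trans BB' (fsubsetUr _ _).
- by move=> b /=; rewrite !inE => /orP[/eqP ->|/B'A].
- by rewrite cardfsU1 B'n (introT negP aB').
Qed.

Lemma infinite_nonzero_latpt {d : nat} :
  (0 < d)%N -> infinite_set [set a : 'rV[int]_d | a != 0].
Proof.
move=> d0; pose g (n : nat) : 'rV[int]_d := const_mx n.+1%:Z.
have g_inj : injective g.
  by move=> m n /rowP/(_ (Ordinal d0)); rewrite !mxE => -[].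
apply/infiniteP; rewrite -(card_le_eql (inj_card_eq (in2W g_inj))).
apply: subset_card_le => _ [n _ <-] /=; apply/eqP => /rowP/(_ (Ordinal d0)).
by rewrite !mxE.
Qed.

(** The least m with k <= m^d works: (m - 1)^d < k, and m <= 2 (m - 1)
    unless m = 1. *)
Lemma exists_root_bound (d k : nat) : (0 < d)%N -> (0 < k)%N ->
  exists2 m : nat, (0 < m)%N & (k <= m ^ d <= 2 ^ d * k)%N.
Proof.
move=> d0 k0.
have ex : exists m, (k <= m ^ d)%N.
  by exists k; rewrite -{1}(expn1 k) leq_pexp2l.
case: (ex_minnP ex) => -[|m] km mmin.
  by move: km; rewrite exp0n // leqNgt k0.
exists m.+1 => //; rewrite km /=.
have [->|m0] := posnP m; first by rewrite exp1n muln_gt0 expn_gt0.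
have mk : (m ^ d < k)%N by rewrite ltnNge; apply/negP => /mmin; rewrite ltnn.
apply: (@leq_trans ((2 * m) ^ d)); first by rewrite leq_exp2r //; lia.
by rewrite expnMn leq_mul2l ltnW ?orbT.
Qed.

(** * Inversion in the unit sphere *)

Definition inversion {R : realType} {d : nat} (a : 'rV[int]_d) : 'rV[R]_d :=
  (dotp (latpt R a) (latpt R a))^-1 *: latpt R a.

(** |inversion a| = 1 / |a|, so the image determines the factor by which a was
    rescaled. *)
Lemma inversion_inj {R : realType} {d : nat} (a b : 'rV[int]_d) :
  a != 0 -> b != 0 -> inversion a = inversion b :> 'rV[R]_d -> a = b.
Proof.
move=> /(@latpt_neq0 R)/dotp_gt0 a0 /(@latpt_neq0 R)/dotp_gt0 b0 ab.
have nn (c : 'rV[int]_d) : 0 < dotp (latpt R c) (latpt R c) ->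
    dotp (inversion c) (inversion c) = (dotp (latpt R c) (latpt R c))^-1.
  by move=> c0; rewrite dotpZr dotpC dotpZr mulVf ?mulr1 // gt_eqF.
have := nn a a0; rewrite ab nn // => /invr_inj nab.
move: ab; rewrite /inversion nab => /scalerI h; apply: (@latpt_inj R); apply: h.
by rewrite invr_neq0 // gt_eqF // -nab.
Qed.

Lemma lt_inversion {R : realType} {d : nat} (x : 'rV[R]_d) (a : 'rV[int]_d) :
  a != 0 -> (1 / 2 < dotp x (inversion a)) <-> closer x a.
Proof.
move=> a0; rewrite closerP dotpZr.
have := dotp_gt0 _ (latpt_neq0 a a0 (R := R)) => aa.
rewrite [_^-1 * _]mulrC ltr_pdivlMr //.
by split=> [h|[_ h]]; [split=> //|]; lra.
Qed.

(** Integers satisfy n <= n^2, so the coordinates of a sum to at most |a|^2.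
    This bounds all inverted lattice points in one direction, which yields a
    half-space that misses them. *)
Lemma dotp_ones_inversion {R : realType} {d : nat} (a : 'rV[int]_d) :
  a != 0 -> dotp (const_mx 1) (inversion a : 'rV[R]_d) <= 1.
Proof.
move=> a0; rewrite dotpZr mulrC ler_pdivrMr ?dotp_gt0 ?latpt_neq0 // mul1r.
apply: ler_sum => i _; rewrite !mxE mul1r -intrM ler_int; nia.
Qed.

(** * From nearer points to j-sets *)

Lemma gt_in_interior {R : realType} {d : nat} (u p : 'rV[R]_d) (c : R) :
  c < dotp u p -> ([set y | c <= dotp u y]°) p.
Proof.
move=> cp; rewrite /interior.
have : \forall y \near p, c < dotp u y.
  exact: (continuous_dotp u p _ (lt_nbhsr cp)).
by apply: filterS => y /ltW.
Qed.

(** Restricting to B only serves to obtain a finite set: B will contain all the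
    nearer points, see [inverted_closerP]. *)
Definition inverted_closer {R : realType} {d : nat} (B : {fset 'rV[int]_d})
    (x : 'rV[R]_d) : {fset 'rV[R]_d} :=
  [fset inversion a | a in B & `[< closer x a >]]%fset.

Lemma inverted_closerP {R : realType} {d : nat} (B : {fset 'rV[int]_d})
    (x : 'rV[R]_d) :
  closer x `<=` [set` B] ->
  [set` inverted_closer B x] = inversion @` closer x.
Proof.
move=> xB; apply/seteqP; split=> p /=.
  by move=> /imfsetP[a /=]; rewrite inE /= => /andP[_ /asboolP xa] ->; exists a.
move=> [a xa <-]; apply/imfsetP; exists a => //=; rewrite inE /=.
by apply/andP; split; [exact: xB|exact/asboolP].
Qed.

Lemma inversion_closer_inj {R : realType} {d : nat} (x y : 'rV[R]_d) :
  inversion @` closer x `<=` (inversion @` closer y : set 'rV[R]_d) ->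
  closer x `<=` closer y.
Proof.
move=> xy a xa; have [b yb] := xy _ (imageP inversion xa).
by move=> /(inversion_inj _ _ yb.1 xa.1) <-.
Qed.

(** The half-space is {p | 1/2 <= <x, p>}; since x lies on no bisector, no
    inverted point lies on its boundary.  For x = 0 this is not a half-space,
    but then no lattice point is nearer and the j-set is empty, so that any
    half-space missing the inversion of B will do. *)
Lemma closer_jset {R : realType} {d : nat} (x : 'rV[R]_d) (j : nat)
    (B : {fset 'rV[int]_d}) :
  (0 < d)%N -> (~` bisectors_union R d) x -> closer x #= `I_j ->
  [set` B] `<=` [set a | a != 0] -> closer x `<=` [set` B] ->
  is_jset j [fset inversion a | a in B]%fset (inverted_closer B x).
Proof.
move=> d0 xU xj B0 xB; split.
  apply/card_eq_fsetP; rewrite inverted_closerP // (card_eql (inj_card_eq _)) //.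
  by move=> a b /set_mem[a0 _] /set_mem[b0 _]; apply: inversion_inj.
rewrite inverted_closerP //.
have [x0|x0] := eqVneq x 0.
  have u0 : const_mx 1 != 0 :> 'rV[R]_d.
    by apply/rV0Pn; exists (Ordinal d0); rewrite mxE oner_eq0.
  exists [set y | 2 <= dotp (const_mx 1) y].
    by exists (const_mx 1) => //; exists 2.
  (* Both sides are empty: nothing is nearer than 0 to the point 0, and inverted
     lattice points have inner product at most 1 with (1, ..., 1). *)
  apply/seteqP; split=> p /=.
    move=> [a /closerP[_ +] _]; rewrite x0 dotpC -(scale0r 0) dotpZr mul0r mulr0.
    by rewrite ltNge dotp_ge0.
  move=> [/imfsetP[a /= /B0 /= a0 ->]] /interior_subset /=.
  rewrite leNgt (le_lt_trans (dotp_ones_inversion a a0)) //.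
  by rewrite ltr1n.
exists [set y | 1 / 2 <= dotp x y]; first by exists x => //; exists (1 / 2).
apply/seteqP; split=> p /=.
  move=> [a xa <-]; split; first by apply/imfsetP; exists a => //; exact: xB.
  by apply: gt_in_interior; apply/lt_inversion => //; case: xa.
move=> [/imfsetP[a /= /B0 /= a0 ->]] /interior_subset /= ha; exists a => //.
apply/lt_inversion => //; rewrite lt_neqAle ha andbT.
have /out_bisectorsP/(_ a a0) := xU; apply: contra => /eqP.
rewrite dotpZr => h; apply/eqP.
have := dotp_gt0 _ (latpt_neq0 a a0 (R := R)) => aa.
have : 1 / 2 * dotp (latpt R a) (latpt R a) = dotp x (latpt R a).
  by rewrite h mulrAC mulVf ?mul1r // gt_eqF.
lra.
Qed.

Theorem theorem5p4 (R : realType) (d : nat) (hd : (0 < d)%N) :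
  exists2 C : nat, (0 < C)%N &
    forall k : nat, (0 < k)%N ->
      brillouin_chambers R d k #<= `I_(max_jsets R d k.-1 (C * k)%N).
Proof.
exists ((10 * d) ^ d)%N; first by rewrite expn_gt0 muln_gt0 hd.
move=> k k0.
have [m m0 /andP[km mk]] := exists_root_bound d k hd k0.
have [B0 [B0n B0P]] := @box_fset d (2 * d * m).
have [||B [B0B BN0 Bn]] := fset_superset_card _ B0 ((10 * d) ^ d * k)
    (infinite_nonzero_latpt hd).
- by move=> a /B0P[].
- apply: leq_trans B0n _.
  apply: (@leq_trans ((5 * d * m) ^ d)); first by rewrite leq_exp2r //; nia.
  have -> : (10 * d = 5 * d * 2)%N by lia.
  by rewrite (expnMn (5 * d) m) (expnMn (5 * d) 2) -mulnA leq_mul2l mk orbT.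
have Sn : #|` [fset inversion a | a in B]%fset : {fset 'rV[R]_d}|
    = ((10 * d) ^ d * k)%N.
  rewrite card_in_imfset //= => a b aB bB; apply: inversion_inj.
  - exact: BN0.
  - exact: BN0.
rewrite -Sn.
apply: (@card_le_trans _ _ _ [set` jsets k.-1 [fset inversion a | a in B]%fset]);
  last first.
  rewrite (card_le_eql (introT card_eq_fsetP erefl)).
  by rewrite card_le_II; exact: card_jsets_le_max.
(* Every chamber of the zone is represented by a point off the bisectors; the
   two counts defining the zone agree there. *)
have witness (D : set 'rV[R]_d) : exists x, brillouin_chambers R d k D ->
    [/\ (~` bisectors_union R d) x,
       D = closure (connected_component (~` bisectors_union R d) x) &
       closer x #= `I_k.-1].
  have [|nD] := pselect (brillouin_chambers R d k D); last by exists 0.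
  move=> /brillouin_chambersE[[x xU xD] Dk]; exists x => _; split=> //.
  have [|h1 h2] := Dk x.
    rewrite -xD; apply: subset_closure; exact: connected_component_refl.
  rewrite card_eq_le h1 /=; apply: card_le_trans h2 _; apply: subset_card_le.
  move=> a [a0 ax]; split=> //; rewrite lt_neqAle ax andbT eq_sym.
  by apply/eqP => xa; apply: xU; exists a.
have [c cP] := choice witness.
have cB D : brillouin_chambers R d k D -> closer (c D) `<=` [set` B].
  move=> /cP[_ _ cDk] a ca; apply/(fsubsetP B0B)/B0P; split; first by case: ca.
  move=> i; apply: closer_coord_le ca.
  rewrite leNgt; apply/negP => /(card_cube_closer _ _ m0).
  by rewrite (card_le_eqr cDk) card_le_II; lia.
have Fi : {in brillouin_chambers R d k &, injective (inverted_closer B \o c)}.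
  move=> D E /set_mem Dk /set_mem Ek /= DE.
  have [DU -> _] := cP D Dk; have [EU -> _] := cP E Ek.
  congr closure; apply: same_component => //.
  have : [set` inverted_closer B (c D)] = [set` inverted_closer B (c E)].
    by rewrite DE.
  rewrite !inverted_closerP; [|exact: cB..] => h.
  by apply/seteqP; split; apply: inversion_closer_inj; rewrite h.
rewrite -(card_le_eql (inj_card_eq Fi)); apply: subset_card_le.
move=> _ [D Dk <-] /=; apply/in_jsets; have [DU _ Dn] := cP D Dk.
by apply: closer_jset => //; exact: cB.
Qed.
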